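(* Let $G$ be a Hausdorff, ample groupoid, $R$ a commutative ring with identity, $\Gamma$ a discrete group with identity $e$, and $c : G \to \Gamma$ a continuous cocycle. Suppose that $G_e := c^{-1}(e)$ is effective. Let $\pi : A_R(G) \to A$ be a graded $R$-algebra homomorphism, where $A_R(G)$ carries the $\Gamma$-grading induced by $c$. Suppose that $\ker(\pi) \neq \{0\}$. Then there is a compact open subset $K \subseteq G^{(0)}$ and $r \in R \setminus \{0\}$ such that $\pi(r 1_K) = 0$.
   Context: Groupoids: for a groupoid $G$, $r(\alpha)=\alpha\alpha^{-1}$ and $s(\alpha)=\alpha^{-1}\alpha$ are the range and source maps (in the claim, the letter $r$ instead denotes a ring element), their common image is the unit space $G^{(0)} \subseteq G$, and $\alpha\beta$ is defined iff $s(\alpha)=r(\beta)$. A topological groupoid is a groupoid with a topology making composition and inversion continuous. An open bisection is an open set $B \subseteq G$ such that $r|_B$ and $s|_B$ are homeomorphisms onto open subsets of $G^{(0)}$. $G$ is ample if it has a basis of compact open bisections. For a topological groupoid $H$ let $\operatorname{Iso}(H)=\{\gamma\in H : s(\gamma)=r(\gamma)\}$; $H$ is effective if the interior (in $H$) of $\operatorname{Iso}(H)\setminus H^{(0)}$ is empty. The subgroupoid $G_e$ has the subspace topology. Steinberg algebra: for $G$ Hausdorff and ample, $A_R(G)$ is the $R$-algebra of all locally constant functions $f: G\to R$ with compact support, with pointwise addition and scalar multiplication and product the convolution $(f*g)(\alpha)=\sum_{r(\beta)=r(\alpha)} f(\beta)g(\beta^{-1}\alpha)$ (a sum with finitely many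 nonzero terms). It need not be unital. For a compact open set $K\subseteq G^{(0)}$ (which is open in $G$), $1_K \in A_R(G)$ denotes its characteristic function. Grading: a continuous cocycle is a continuous map $c: G\to\Gamma$ with $c(\alpha\beta)=c(\alpha)c(\beta)$ whenever $\alpha\beta$ is defined. For $n\in\Gamma$ put $G_n = c^{-1}(n)$ and let $A_R(G)_n$ be the set of $f\in A_R(G)$ with support contained in $G_n$; this makes $A_R(G)=\bigoplus_{n\in\Gamma}A_R(G)_n$ a $\Gamma$-graded algebra. Here $A=\bigoplus_{n\in\Gamma} A_n$ is a $\Gamma$-graded $R$-algebra, and $\pi: A_R(G)\to A$ is graded if $\pi(A_R(G)_n)\subseteq A_n$ for all $n\in\Gamma$. *)

(* Defs.v *)
From HB Require Import structures.
From mathcomp Require Import all_boot all_algebra.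
From mathcomp Require Import all_classical topology.

Set Implicit Arguments.
Unset Strict Implicit.
Unset Printing Implicit Defensive.

Import GRing.Theory.

Local Open Scope classical_set_scope.
Local Open Scope ring_scope.

(* Groupoids are given by Renault's axioms.  The multiplication is a total
   function: [gmul a b] is meaningful only when [gcomp a b], that is when
   s(a) = r(b), and no axiom constrains its value otherwise. *)
HB.mixin Record isGroupoid G := {
  gmul : G -> G -> G;
  ginv : G -> G;
  ginvK : involutive ginv;
  gmul_assoc : forall a b d,
    gmul (ginv a) a = gmul b (ginv b) -> gmul (ginv b) b = gmul d (ginv d) ->
    [/\ gmul (ginv (gmul a b)) (gmul a b) = gmul d (ginv d),
        gmul (ginv a) a = gmul (gmul b d) (ginv (gmul b d)) &
        gmul (gmul a b) d = gmul a (gmul b d)];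
  gmulKV : forall a b,
    gmul (ginv a) a = gmul b (ginv b) -> gmul (ginv a) (gmul a b) = b;
  gmulVK : forall a b,
    gmul (ginv a) a = gmul b (ginv b) -> gmul (gmul a b) (ginv b) = a
}.

#[short(type="groupoidType")]
HB.structure Definition Groupoid := { G of isGroupoid G }.

Arguments gmul_assoc {s} [a b d] _ _.
Arguments gmulKV {s} [a b] _.
Arguments gmulVK {s} [a b] _.

Section GroupoidDefs.
Variable G : groupoidType.

Definition grng (a : G) : G := gmul a (ginv a).
Definition gsrc (a : G) : G := gmul (ginv a) a.
Definition gcomp (a b : G) : Prop := gsrc a = grng b.
Definition gunits : set G := range grng.

End GroupoidDefs.

HB.mixin Record isTopologicalGroupoid G of Groupoid G & Topological G := {
  ginv_continuous : continuous (@ginv G);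
  gmul_continuous : {within [set p : G * G | gcomp p.1 p.2],
                      continuous (fun p : G * G => gmul p.1 p.2)}
}.

#[short(type="topologicalGroupoidType")]
HB.structure Definition TopologicalGroupoid :=
  { G of Groupoid G & Topological G & isTopologicalGroupoid G }.

Section TopologicalGroupoidDefs.
Variable G : topologicalGroupoidType.

(* [f] restricts to a homeomorphism from [B] onto an open subset of the unit
   space, all subsets carrying the subspace topology. *)
Definition homeo_onto_open_units (f : G -> G) (B : set G) : Prop :=
  [/\ {within B, continuous f},
      exists2 g : G -> G,
        {within f @` B, continuous g} & forall b, B b -> g (f b) = b &
      exists2 U : set G, open U & f @` B = U `&` @gunits G].

Definition open_bisection (B : set G) : Prop :=
  [/\ open B, homeo_onto_open_units (@grng G) B &
      homeo_onto_open_units (@gsrc G) B].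

Definition ample : Prop :=
  basis [set B : set G | compact B /\ open_bisection B].

(* For a subgroupoid [H] of [G], with the subspace topology: [grng @` H] is the
   unit space of [H], and the interior is computed in [H]. *)
Definition effective (H : set G) : Prop :=
  @interior (subspace H)
    ([set a | H a /\ gsrc a = grng a] `\` (@grng G @` H)) = set0.

Definition continuous_cocycle (Gam : groupType) (c : G -> Gam) : Prop :=
  continuous (c : G -> discrete_topology Gam) /\
  forall a b, gcomp a b -> c (gmul a b) = (c a * c b)%g.

End TopologicalGroupoidDefs.

HB.mixin Record isHausdorffAmple G of TopologicalGroupoid G := {
  groupoid_hausdorff : hausdorff_space G;
  groupoid_ample : ample G
}.

#[short(type="hausdorffAmpleGroupoidType")]
HB.structure Definition HausdorffAmpleGroupoid :=
  { G of TopologicalGroupoid G & isHausdorffAmple G }.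

(* Associative algebras, not necessarily unital. *)
HB.mixin Record Lmodule_isAssocAlgebra (R : comPzRingType) A
    of GRing.Lmodule R A := {
  amul : A -> A -> A;
  amulA : associative amul;
  amulDl : left_distributive amul +%R;
  amulDr : right_distributive amul +%R;
  ascaleAl : forall (k : R) (x y : A), k *: amul x y = amul (k *: x) y;
  ascaleAr : forall (k : R) (x y : A), k *: amul x y = amul x (k *: y)
}.

#[short(type="assocAlgType")]
HB.structure Definition AssocAlgebra (R : comPzRingType) :=
  { A of GRing.Lmodule R A & Lmodule_isAssocAlgebra R A }.

Notation "x ** y" := (amul x y) (at level 40, left associativity).

(* The fields [grading_sum] and [grading_direct] say that [A] is the direct sum
   of the submodules [A_ n]. *)
Record is_grading (R : comPzRingType) (Gam : groupType) (A : assocAlgType R)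
    (A_ : Gam -> set A) : Prop := {
  grading0 : forall n, A_ n 0;
  gradingD : forall n x y, A_ n x -> A_ n y -> A_ n (x + y);
  gradingZ : forall n (k : R) x, A_ n x -> A_ n (k *: x);
  grading_sum : forall x, exists (s : seq Gam) (x_ : Gam -> A),
    (forall n, A_ n (x_ n)) /\ x = \sum_(n <- s) x_ n;
  grading_direct : forall (s : seq Gam) (x_ : Gam -> A), uniq s ->
    (forall n, A_ n (x_ n)) -> \sum_(n <- s) x_ n = 0 ->
    forall n, n \in s -> x_ n = 0;
  gradingM : forall m n x y, A_ m x -> A_ n y -> A_ (m * n)%g (x ** y)
}.

Section SteinbergDefs.
Variables (G : topologicalGroupoidType) (R : comPzRingType).
Implicit Types f g : G -> R^o.

Definition locally_constant f : Prop := forall a, \forall b \near a, f b = f a.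

(* For a locally constant function this set is clopen, so there is no need to
   take its closure. *)
Definition supp f : set G := [set a | f a != 0].

Definition is_steinberg f : Prop := locally_constant f /\ compact (supp f).

(* For [f] and [g] in the Steinberg algebra the sum has finitely many nonzero
   terms; see [finite_fiber]. *)
Definition convolution f g : G -> R^o :=
  fun a => \sum_(b \in [set b | grng b = grng a]) f b * g (gmul (ginv b) a).

End SteinbergDefs.

Section GroupoidTheory.
Variable G : groupoidType.
Implicit Types a b d : G.

Lemma gsrcV a : gsrc (ginv a) = grng a.
Proof. by rewrite /gsrc /grng ginvK. Qed.

Lemma grngV a : grng (ginv a) = gsrc a.
Proof. by rewrite /gsrc /grng ginvK. Qed.

Lemma gcompVl a : gcomp (ginv a) a.
Proof. exact: gsrcV. Qed.

Lemma gcompVr a : gcomp a (ginv a).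
Proof. by rewrite /gcomp grngV. Qed.

Lemma grngM a b : gcomp a b -> grng (gmul a b) = grng a.
Proof.
by move=> cab; have [_ h _] := gmul_assoc (gcompVl a) cab; rewrite -(gsrcV a).
Qed.

Lemma gsrcM a b : gcomp a b -> gsrc (gmul a b) = gsrc b.
Proof.
by move=> cab; have [h _ _] := gmul_assoc cab (gcompVr b); rewrite -(grngV b).
Qed.

Lemma gmulA a b d : gcomp a b -> gcomp b d ->
  gmul (gmul a b) d = gmul a (gmul b d).
Proof. by move=> cab cbd; have [_ _] := gmul_assoc cab cbd. Qed.

Lemma gcompV a b : grng a = grng b -> gcomp (ginv a) b.
Proof. by rewrite /gcomp gsrcV. Qed.

Lemma gmulVKr a b : grng a = grng b -> gmul a (gmul (ginv a) b) = b.
Proof. by move=> /gcompV h; rewrite -{1}(ginvK a) gmulKV. Qed.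

Lemma grngVM a b : grng a = grng b -> grng (gmul (ginv a) b) = gsrc a.
Proof. by move=> /gcompV h; rewrite grngM// grngV. Qed.

Lemma gcompVM a b : grng a = grng b -> gcomp a (gmul (ginv a) b).
Proof. by move=> h; rewrite /gcomp grngVM. Qed.

Lemma gsrcVM a b : grng a = grng b -> gsrc (gmul (ginv a) b) = gsrc b.
Proof. by move=> /gcompV h; rewrite gsrcM. Qed.

Lemma gunits_grng a : gunits (grng a).
Proof. by exists a. Qed.

Lemma gmulVM a b d : gcomp a b -> grng a = grng d ->
  gmul (ginv (gmul a b)) d = gmul (ginv b) (gmul (ginv a) d).
Proof.
move=> cab rad; set x := RHS.
have rb : grng b = grng (gmul (ginv a) d) by rewrite grngVM.
have cbx : gcomp b x by exact: gcompVM.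
have <- : gmul (gmul a b) x = d by rewrite gmulA// /x !gmulVKr.
by rewrite gmulKV// -/(gsrc _) -/(grng _) gsrcM.
Qed.

End GroupoidTheory.

Section CompactTheory.
Variable T : topologicalType.

Lemma compact_ind (P : set T -> Prop) (K : set T) : compact K -> P set0 ->
  (forall A B, A `<=` B -> P B -> P A) ->
  (forall A B, P A -> P B -> P (A `|` B)) ->
  (forall x, K x -> exists2 U, nbhs x U & P U) -> P K.
Proof.
move=> Kc P0 PS PU Ploc; apply: contrapT => nPK.
pose F : set_system T := [set B | P (K `\` B)].
have FF : ProperFilter F.
  split; first by rewrite /F/= setD0.
  split; rewrite /F/= ?setDT//.
    by move=> A B PA PB; rewrite /F/= setDE setCI setIUr; exact: PU.
  by move=> A B AB; apply: PS => x [Kx nBx]; split=> // /AB.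
have FK : F K by rewrite /F/= setDv.
have [x [Kx clx]] := Kc F FF FK.
have [U Ux PUU] := Ploc _ Kx.
have FU : F (~` U).
  by apply: PS PUU => y [_ /contrapT].
by have [y []] := clx _ _ FU Ux.
Qed.

End CompactTheory.

Section FsbigTheory.
Variables (T : choiceType) (R : comPzRingType).

Lemma fsum_widen (P Q : set T) (F : T -> R) : Q `<=` P ->
  (forall i, P i -> ~ Q i -> F i = 0) ->
  \sum_(i \in P) F i = \sum_(i \in Q) F i.
Proof. by move=> QP F0; apply/esym/fsbig_widen => // i [Pi /F0]; apply. Qed.

Lemma fsum_split (P : set T) (F F' : T -> R) : finite_set P ->
  \sum_(i \in P) (F i + F' i) = \sum_(i \in P) F i + \sum_(i \in P) F' i.
Proof. by move=> Pf; rewrite !fsbig_finite//= big_split. Qed.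

Lemma fsum_distrr (P : set T) (F : T -> R) k : finite_set P ->
  k * (\sum_(i \in P) F i) = \sum_(i \in P) k * F i.
Proof. by move=> Pf; rewrite !fsbig_finite//= mulr_sumr. Qed.

Lemma fsum_distrl (P : set T) (F : T -> R) k : finite_set P ->
  (\sum_(i \in P) F i) * k = \sum_(i \in P) F i * k.
Proof. by move=> Pf; rewrite !fsbig_finite//= mulr_suml. Qed.

End FsbigTheory.

Section TopologicalGroupoidTheory.
Variable G : topologicalGroupoidType.
Implicit Types (a b : G) (B : set G).

Lemma cvg_gmul (I : Type) (F : set_system I) {FF : Filter F}
    (u v : I -> G) a b :
  gcomp a b -> (\forall i \near F, gcomp (u i) (v i)) ->
  u @ F --> a -> v @ F --> b -> (fun i => gmul (u i) (v i)) @ F --> gmul a b.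
Proof.
move=> cab cuv ua vb.
have /subspace_continuousP/(_ (a, b) cab) m := @gmul_continuous G.
move=> W /m /=; rewrite /nbhs/= => -[[U V] [/= aU bV] UVW].
have uU : F (u @^-1` U) by exact: ua.
have vV : F (v @^-1` V) by exact: vb.
apply: filterS3 uU vV cuv => i /= Ui Vi ci.
exact: (UVW (u i, v i)).
Qed.

Lemma grng_continuous : continuous (@grng G).
Proof.
move=> a; apply: (cvg_gmul (FF := nbhs_filter a) (gcompVr a)).
- by apply: nearW => b; exact: gcompVr.
- exact: cvg_id.
- exact: ginv_continuous.
Qed.

Lemma gsrc_continuous : continuous (@gsrc G).
Proof.
move=> a; apply: (cvg_gmul (FF := nbhs_filter a) (gcompVl a)).
- by apply: nearW => b; exact: gcompVl.
- exact: ginv_continuous.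
- exact: cvg_id.
Qed.

Lemma open_bisection_grng_inj B a b : open_bisection B -> B a -> B b ->
  grng a = grng b -> a = b.
Proof.
by move=> [_ [_ [g _ gK] _] _] Ba Bb rab; rewrite -(gK a)// -(gK b)// rab.
Qed.

Lemma open_bisection_gsrc_inj B a b : open_bisection B -> B a -> B b ->
  gsrc a = gsrc b -> a = b.
Proof.
by move=> [_ _ [_ [g _ gK] _]] Ba Bb rab; rewrite -(gK a)// -(gK b)// rab.
Qed.

End TopologicalGroupoidTheory.

Section HausdorffAmpleTheory.
Variable G : hausdorffAmpleGroupoidType.
Implicit Types (a b : G) (B K : set G).

Lemma ample_nbhs a (U : set G) : nbhs a U ->
  exists B, [/\ compact B, open_bisection B, B a & B `<=` U].
Proof.
have [_ /(_ a) h] := @groupoid_ample G.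
by move=> /h [B /= [[cB oB] Ba] BU]; exists B.
Qed.

Lemma finite_fiber K a : compact K -> finite_set (K `&` [set b | grng b = a]).
Proof.
move=> cK.
apply: (compact_ind (P := fun A => finite_set (A `&` [set b | grng b = a]))) cK _ _ _ _.
- by rewrite set0I.
- by move=> A B AB; apply: sub_finite_set; exact: setSI.
- by move=> A B fA fB; rewrite setIUl finite_setU.
- move=> x _; have [B [_ oB Bx _]] := ample_nbhs (@filterT _ (nbhs x) _).
  exists B; first by apply: open_nbhs_nbhs; split=> //; have [] := oB.
  have [->|/set0P[b [Bb rb]]] := eqVneq (B `&` [set b | grng b = a]) set0 => //.
  apply: (@sub_finite_set _ _ [set b]) => // y [By ry] /=.
  by apply: (open_bisection_grng_inj oB) => //; rewrite ry rb.
Qed.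

Lemma finite_sfiber K a : compact K -> finite_set (K `&` [set b | gsrc b = a]).
Proof.
move=> cK.
apply: (compact_ind (P := fun A => finite_set (A `&` [set b | gsrc b = a]))) cK _ _ _ _.
- by rewrite set0I.
- by move=> A B AB; apply: sub_finite_set; exact: setSI.
- by move=> A B fA fB; rewrite setIUl finite_setU.
- move=> x _; have [B [_ oB Bx _]] := ample_nbhs (@filterT _ (nbhs x) _).
  exists B; first by apply: open_nbhs_nbhs; split=> //; have [] := oB.
  have [->|/set0P[b [Bb rb]]] := eqVneq (B `&` [set b | gsrc b = a]) set0 => //.
  apply: (@sub_finite_set _ _ [set b]) => // y [By ry] /=.
  by apply: (open_bisection_gsrc_inj oB) => //; rewrite ry rb.
Qed.

Lemma gcomp_closed : closed [set p : G * G | gcomp p.1 p.2].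
Proof.
rewrite -[X in closed X]setCK; apply: open_closedC; rewrite openE => -[a b] /= /eqP nab.
have := @groupoid_hausdorff G; rewrite open_hausdorff => /(_ _ _ nab).
move=> [[U V] /= [/set_mem Ua /set_mem Vb] [oU oV /eqP UV]].
have na : nbhs a (@gsrc G @^-1` U).
  by apply: gsrc_continuous; exact: open_nbhs_nbhs.
have nb : nbhs b (@grng G @^-1` V).
  by apply: grng_continuous; exact: open_nbhs_nbhs.
exists (@gsrc G @^-1` U, @grng G @^-1` V) => //= -[x y] [/= Ux Vy] cxy.
have : (U `&` V) (gsrc x) by split=> //; rewrite cxy.
by rewrite UV.
Qed.

End HausdorffAmpleTheory.

Section Steinberg.
Variables (G : hausdorffAmpleGroupoidType) (R : comPzRingType).
Implicit Types f g h : G -> R^o.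
Local Notation stein := (@is_steinberg G R).

Lemma locally_constant_open f (D : set R) : locally_constant f ->
  open (f @^-1` D).
Proof.
move=> lf; rewrite openE => a /= Da; rewrite /interior.
by apply: filterS (lf a) => b /= ->.
Qed.

Lemma locally_constant_closed f (D : set R) : locally_constant f ->
  closed (f @^-1` D).
Proof.
move=> lf; rewrite -[X in closed X]setCK preimage_setC.
exact/open_closedC/locally_constant_open.
Qed.

Lemma supp_closed f : locally_constant f -> closed (supp f).
Proof. exact: (@locally_constant_closed f [set x | x != 0]). Qed.

Lemma is_steinberg0 : stein 0.
Proof.
split; first by move=> a; apply: nearW.
rewrite (_ : supp _ = set0); first exact: compact0.
by apply/seteqP; split=> a //=; rewrite /supp/= eqxx.
Qed.

Lemma is_steinbergP f K : locally_constant f -> compact K -> supp f `<=` K ->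
  stein f.
Proof.
by move=> lf cK fK; split=> //; apply: subclosed_compact cK fK; exact: supp_closed.
Qed.

Lemma is_steinberg_lin (k : R) f g : stein f -> stein g -> stein (k *: f + g).
Proof.
move=> [lf cf] [lg cg]; apply: (@is_steinbergP _ (supp f `|` supp g)).
- move=> a; apply: filterS2 (lf a) (lg a) => b fb gb.
  by rewrite !fctE fb gb.
- exact: compactU.
- move=> a; rewrite /supp/= !fctE; apply: contraPP => /not_orP[].
  by move=> /negP/negPn/eqP-> /negP/negPn/eqP->; rewrite scaler0 addr0 eqxx.
Qed.

Lemma is_steinbergD f g : stein f -> stein g -> stein (f + g).
Proof. by move=> sf sg; rewrite -[f]scale1r; exact: is_steinberg_lin. Qed.

Definition restr (C : set G) f : G -> R^o :=
  fun a => if a \in C then f a else 0.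

Lemma is_steinberg_restr (C : set G) f : clopen C -> stein f ->
  stein (restr C f).
Proof.
move=> [oC cC] [lf cf]; apply: is_steinbergP (cf) _.
- move=> a; rewrite /restr; have [/set_mem Ca|/negP nCa] := boolP (a \in C).
    apply: filterS2 (lf a) (open_nbhs_nbhs (conj oC Ca)) => b -> Cb.
    by rewrite mem_set.
  have nC : (~` C) a by move=> Ca; apply: nCa; rewrite inE.
  have oC' : open (~` C) by exact: closed_openC.
  apply: filterS (open_nbhs_nbhs (conj oC' nC)) => b Cb.
  by rewrite memNset.
- by move=> a; rewrite /supp/restr/=; case: ifP => //; rewrite eqxx.
Qed.

Lemma steinberg_ind (Q : (G -> R^o) -> Prop) : Q 0 ->
  (forall f g, stein f -> stein g -> Q f -> Q g -> Q (f + g)) ->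
  (forall f B, stein f -> compact B -> open_bisection B -> supp f `<=` B ->
     Q f) ->
  forall f, stein f -> Q f.
Proof.
move=> Q0 QD QB f sf.
pose P A := exists C, [/\ clopen C, A `<=` C &
  forall f, stein f -> supp f `<=` C -> Q f].
suff [C [_ fC]] : P (supp f) by apply.
apply: (compact_ind sf.2).
- exists set0; split=> //; first exact: clopen0.
  move=> g _ g0; suff -> : g = 0 by [].
  by apply/funext => a; apply/eqP/negPn/negP => /g0.
- by move=> A B AB [C [cC BC hC]]; exists C; split=> //; exact: subset_trans BC.
- move=> A B [C [cC AC hC]] [C' [cC' BC' hC']]; exists (C `|` C'); split.
  + exact: clopenU.
  + exact: setUSS.
  + move=> g sg gCC'.
    have cCC : clopen (~` C) by split; [exact: closed_openC cC.2|exact: open_closedC cC.1].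
    rewrite (_ : g = restr C g + restr (~` C) g); last first.
      apply/funext => a; rewrite !fctE /restr in_setC.
      by case: (a \in C); rewrite /= ?addr0 ?add0r.
    have s1 := is_steinberg_restr cC sg.
    have s2 := is_steinberg_restr cCC sg.
    apply: QD => //.
    * apply: hC => // a; rewrite /supp/restr/=.
      by case: ifPn => [/set_mem//|]; rewrite eqxx.
    * apply: hC' => // a; rewrite /supp/restr/=.
      by case: ifPn => [/set_mem/= nCa /gCC'[]//|]; rewrite eqxx.
- move=> a _; have [B [cB oB Ba _]] := ample_nbhs (@filterT _ (nbhs a) _).
  have oB' : open B by have [] := oB.
  exists B; first exact: open_nbhs_nbhs.
  exists B; split=> //.
    by split=> //; apply: compact_closed => //; exact: groupoid_hausdorff.
  by move=> g sg gB; exact: QB oB gB.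
Qed.

Lemma convolutionE f g a (S : set G) : supp f `&` [set b | grng b = grng a] `<=` S ->
  S `<=` [set b | grng b = grng a] ->
  convolution f g a = \sum_(b \in S) f b * g (gmul (ginv b) a).
Proof.
move=> fS Sa; apply: fsum_widen => // b rb nSb.
have -> : f b = 0 by apply/eqP/negPn/negP => fb; apply: nSb; exact: fS.
by rewrite mul0r.
Qed.

Lemma convolution_fin f g a : stein f ->
  convolution f g a =
  \sum_(b \in supp f `&` [set b | grng b = grng a]) f b * g (gmul (ginv b) a).
Proof. by move=> sf; apply: convolutionE => // b []. Qed.

Lemma convolutionDl f f' g : stein f -> stein f' ->
  convolution (f + f') g = convolution f g + convolution f' g.
Proof.
move=> [_ cf] [_ cf']; apply/funext => a; rewrite !fctE.
pose S := (supp f `|` supp f') `&` [set b | grng b = grng a].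
have fS : finite_set S by apply: finite_fiber; exact: compactU.
rewrite !(@convolutionE _ _ _ S) /S; try by move=> b [].
- rewrite -fsum_split//; apply: eq_fsbigr => b _;
  by rewrite -mulrDl.
- by apply: setSI => b fb; right.
- by apply: setSI => b fb; left.
- apply: setSI => b; rewrite /supp/=; apply: contraPP => /not_orP[].
  by move=> /negP/negPn/eqP-> /negP/negPn/eqP->; rewrite addr0 eqxx.
Qed.

Lemma convolutionDr f g g' : stein f ->
  convolution f (g + g') = convolution f g + convolution f g'.
Proof.
move=> sf; apply/funext => a; rewrite !fctE !convolution_fin//.
rewrite -fsum_split; last by apply: finite_fiber; have [] := sf.
by apply: eq_fsbigr => b _; rewrite -mulrDr.
Qed.

Lemma convolutionZl (k : R) f g : stein f ->
  k *: convolution f g = convolution (k *: f) g.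
Proof.
move=> sf; apply/funext => a; rewrite !fctE [in LHS]convolution_fin//.
have fS : finite_set (supp f `&` [set b | grng b = grng a]).
  by apply: finite_fiber; have [] := sf.
rewrite [LHS]fsum_distrr// [RHS](@convolutionE _ _ _ (supp f `&` [set b | grng b = grng a])).
- by apply: eq_fsbigr => b _; rewrite mulrA.
- apply: setSI => b; rewrite /supp/=; apply: contraNN => /eqP fb.
  by rewrite fb scaler0.
- by move=> b [].
Qed.

Lemma convolutionZr (k : R) f g : stein f ->
  k *: convolution f g = convolution f (k *: g).
Proof.
move=> sf; apply/funext => a; rewrite !fctE !convolution_fin//.
have fS : finite_set (supp f `&` [set b | grng b = grng a]).
  by apply: finite_fiber; have [] := sf.
rewrite [LHS]fsum_distrr//.
by apply: eq_fsbigr => b _; rewrite [LHS]mulrCA.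
Qed.

Lemma convolution0l g : convolution 0 g = 0.
Proof.
apply/funext => a; rewrite (@convolutionE _ _ _ set0) ?fsbig_set0//.
by move=> b []; rewrite /supp/= eqxx.
Qed.

Lemma convolution_supp f g a : convolution f g a != 0 ->
  exists b, [/\ grng b = grng a, supp f b & supp g (gmul (ginv b) a)].
Proof.
move=> /eqP conv; apply: contrapT => nex; apply: conv.
apply: fsbig1 => b /= rb; apply: contrapT => /eqP fg; apply: nex.
exists b; split=> //.
- by apply: contraNN fg => /eqP ->; rewrite mul0r.
- by apply: contraNN fg => /eqP ->; rewrite mulr0.
Qed.

Lemma convolution_bisection f g B a b : open_bisection B -> supp f `<=` B ->
  B b -> grng b = grng a -> convolution f g a = f b * g (gmul (ginv b) a).
Proof.
move=> oB fB Bb rb; rewrite (@convolutionE _ _ _ [set b]) ?fsbig_set1//.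
  by move=> d [/fB Bd /= rd]; apply: (open_bisection_grng_inj oB) => //; rewrite rd rb.
by move=> _ ->.
Qed.

Lemma convolution_locally_constant f g B : stein f -> stein g -> compact B ->
  open_bisection B -> supp f `<=` B -> locally_constant (convolution f g).
Proof.
move=> [lf _] [lg _] cB oB fB a.
have [_ [_ [sg csg sgK] [U oU rBU]] _] := oB.
have [[b Bb rb]|nBa] := pselect ((@grng G @` B) (grng a)); last first.
  have conv0 d : ~ (@grng G @` B) (grng d) -> convolution f g d = 0.
    move=> nBd; apply: contrapT => /eqP /convolution_supp[b [rb fb _]].
    by apply: nBd; exists b => //; exact: fB.
  have crB : closed (@grng G @` B).
    apply: compact_closed; first exact: groupoid_hausdorff.
    apply: continuous_compact cB; apply: continuous_subspaceT.
    exact: grng_continuous.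
  have oN : open (@grng G @^-1` (~` (@grng G @` B))).
    apply: open_comp; first by move=> *; exact: grng_continuous.
    exact: closed_openC.
  by apply: filterS (open_nbhs_nbhs (conj oN nBa)) => d nBd; rewrite !conv0.
have near_r : \forall d \near a, (@grng G @` B) (grng d).
  rewrite rBU; have Ua : U (grng a).
    by have : (@grng G @` B) (grng a) by [exists b]; rewrite rBU => -[].
  have : nbhs a (@grng G @^-1` U).
    by apply: grng_continuous; exact: open_nbhs_nbhs.
  by apply: filterS => d Ud; split=> //; exact: gunits_grng.
have sgE d : (@grng G @` B) (grng d) -> B (sg (grng d)) /\ grng (sg (grng d)) = grng d.
  by move=> [e Be re]; rewrite -re sgK.
have sga : sg (grng a) = b by rewrite -rb sgK.
have sg_cvg : (fun d => sg (grng d)) @ a --> b.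
  have rBa : (@grng G @` B) (grng a) by exists b.
  have /subspace_continuousP/(_ _ rBa) h := csg.
  rewrite -sga => W /h /(grng_continuous (x := a)) /= hW.
  by apply: filterS2 near_r hW => d rd; apply.
have m_cvg : (fun d => gmul (ginv (sg (grng d))) d) @ a --> gmul (ginv b) a.
  apply: cvg_gmul; first exact: gcompV.
  - by apply: filterS near_r => d /sgE[_ rd]; exact: gcompV.
  - exact: cvg_comp sg_cvg (@ginv_continuous G b).
  - exact: cvg_id.
have nf : \forall d \near a, f (sg (grng d)) = f b.
  exact: (sg_cvg _ (lf b)).
have ng : \forall d \near a, g (gmul (ginv (sg (grng d))) d) = g (gmul (ginv b) a).
  exact: (m_cvg _ (lg (gmul (ginv b) a))).
apply: filterS3 near_r nf ng => d /sgE[Bd rd] /= fd gd.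
by rewrite (convolution_bisection g oB fB Bd rd) fd gd (convolution_bisection g oB fB Bb rb).
Qed.

Lemma is_steinberg_convolution f g : stein f -> stein g ->
  stein (convolution f g).
Proof.
move=> sf sg; move: f sf; apply: steinberg_ind.
- by rewrite convolution0l; exact: is_steinberg0.
- by move=> f f' sf sf' h h'; rewrite convolutionDl//; exact: is_steinbergD.
move=> f B sf cB oB fB.
pose D := (supp f `*` supp g) `&` [set p : G * G | gcomp p.1 p.2].
have cD : compact D.
  apply: compact_closedI; last exact: gcomp_closed.
  by apply: compact_setX; [case: sf|case: sg].
apply: (@is_steinbergP _ ((fun p : G * G => gmul p.1 p.2) @` D)).
- exact: convolution_locally_constant oB fB.
- apply: continuous_compact cD; apply: continuous_subspaceW (@gmul_continuous G).
  by move=> p [].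
- move=> a /convolution_supp[b [rb fb gb]].
  exists (b, gmul (ginv b) a); last by rewrite /= gmulVKr.
  by split; [split|exact: gcompVM].
Qed.

Lemma convolutionA f g h : stein f -> stein g -> stein h ->
  convolution f (convolution g h) = convolution (convolution f g) h.
Proof.
move=> sf sg sh; apply/funext => a.
pose F := supp f `&` [set b | grng b = grng a].
pose D := [set d | grng d = grng a /\ supp h (gmul (ginv d) a)].
have fF : finite_set F by apply: finite_fiber; case: sf.
have fD : finite_set D.
  have := finite_sfiber (gsrc a) sh.2.
  move=> /(finite_image (fun x => gmul a (ginv x))); apply: sub_finite_set.
  move=> d [rd hd]; exists (gmul (ginv d) a).
    by split=> //=; rewrite gsrcVM.
  rewrite -{1}(gmulVKr rd) gmulVK//; exact: gcompVM.
rewrite convolution_fin// -/F.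
transitivity (\sum_(b \in F) \sum_(d \in D)
    (f b * g (gmul (ginv b) d) * h (gmul (ginv d) a) : R)).
  apply: eq_fsbigr => b /set_mem [fb rb].
  rewrite {1}/convolution (reindex_fsbig (fun d => gmul (ginv b) d)
    [set d | grng d = grng a] [set d | grng d = grng (gmul (ginv b) a)]); last first.
    split.
    - by move=> d /= rd; rewrite !grngVM// rd.
    - move=> d d' /set_mem/= rd /set_mem/= rd' E.
      by rewrite -(@gmulVKr _ b d) ?rd// E gmulVKr ?rd'.
    - move=> d /=; rewrite grngVM// => rd.
      have cbd : gcomp b d by [].
      by exists (gmul b d); rewrite /= ?grngM ?gmulKV.
  have E d : grng d = grng a ->
      gmul (ginv (gmul (ginv b) d)) (gmul (ginv b) a) = gmul (ginv d) a.
    move=> rd; have rbd : grng b = grng d by rewrite rb rd.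
    by rewrite -(@gmulVM _ b) ?gmulVKr//; exact: gcompVM.
  rewrite [X in f b * X](@fsum_widen _ _ [set d | grng d = grng a] D).
  - rewrite fsum_distrr//; apply: eq_fsbigr => d /set_mem[rd hd].
    by rewrite mulrA E.
  - by move=> d [].
  - move=> d /= rd nDd; rewrite E//.
    suff -> : h (gmul (ginv d) a) = 0 by rewrite mulr0.
    by apply/eqP/negPn/negP => hd; apply: nDd.
rewrite exchange_fsbig// [RHS](@fsum_widen _ _ _ D).
- apply: eq_fsbigr => d /set_mem[rd hd].
  rewrite convolution_fin// fsum_distrl; first by rewrite rd.
  by rewrite rd.
- by move=> d [].
- move=> d /= rd nDd; suff -> : h (gmul (ginv d) a) = 0 by rewrite mulr0.
  by apply/eqP/negPn/negP => hd; apply: nDd.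
Qed.

Lemma is_steinberg_char (K : set G) : open K -> compact K ->
  stein (fun a => (a \in K)%:R).
Proof.
move=> oK cK; have clK : clopen K.
  by split=> //; apply: compact_closed => //; exact: groupoid_hausdorff.
apply: (@is_steinbergP _ K) => //.
- move=> a; have [/set_mem Ka|/negP nKa] := boolP (a \in K).
    by apply: filterS (open_nbhs_nbhs (conj oK Ka)) => b Kb; rewrite mem_set.
  have nK : (~` K) a by move=> Ka; apply: nKa; rewrite inE.
  have oK' : open (~` K) by apply: closed_openC; have [] := clK.
  by apply: filterS (open_nbhs_nbhs (conj oK' nK)) => b Kb; rewrite memNset.
- move=> a; rewrite /supp/=; case: (boolP (a \in K)) => [/set_mem//|_].
  by rewrite eqxx.
Qed.

End Steinberg.

Section SteinbergAlgebra.
Variables (G : hausdorffAmpleGroupoidType) (R : comPzRingType).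

Definition steinberg_pred : {pred G -> R^o} := [pred f | `[< is_steinberg f >]].

Lemma steinberg_predP (f : G -> R^o) : reflect (is_steinberg f) (f \in steinberg_pred).
Proof. exact: asboolP. Qed.

Lemma steinberg_submod_closed : submod_closed steinberg_pred.
Proof.
split; first by apply/steinberg_predP; exact: is_steinberg0.
move=> k f g /steinberg_predP sf /steinberg_predP sg.
by apply/steinberg_predP; exact: is_steinberg_lin.
Qed.

HB.instance Definition _ :=
  GRing.isSubmodClosed.Build R (G -> R^o) steinberg_pred steinberg_submod_closed.

Record steinberg := Steinberg {
  steinberg_fun :> G -> R^o;
  _ : steinberg_fun \in steinberg_pred
}.

HB.instance Definition _ := [isSub for steinberg_fun].
HB.instance Definition _ := [Choice of steinberg by <:].
HB.instance Definition _ := [SubChoice_isSubLmodule of steinberg by <:].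

Implicit Types f g h : steinberg.

Lemma steinbergP f : is_steinberg f.
Proof. exact/steinberg_predP/(valP f). Qed.

Lemma steinberg_eqP f g : (forall a, f a = g a) -> f = g.
Proof. by move=> fg; apply: val_inj; apply/funext. Qed.

Definition to_steinberg (f : G -> R^o) (sf : is_steinberg f) : steinberg :=
  Steinberg (introT (steinberg_predP f) sf).

Definition steinberg_mul f g : steinberg :=
  to_steinberg (is_steinberg_convolution (steinbergP f) (steinbergP g)).

Lemma steinberg_mulA : associative steinberg_mul.
Proof.
by move=> f g h; apply: val_inj; apply: convolutionA; exact: steinbergP.
Qed.

Lemma steinberg_mulDl : left_distributive steinberg_mul +%R.
Proof.
by move=> f g h; apply: val_inj; apply: convolutionDl; exact: steinbergP.
Qed.

Lemma steinberg_mulDr : right_distributive steinberg_mul +%R.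
Proof.
by move=> f g h; apply: val_inj; apply: convolutionDr; exact: steinbergP.
Qed.

Lemma steinberg_scaleAl (k : R) f g :
  k *: steinberg_mul f g = steinberg_mul (k *: f) g.
Proof. by apply: val_inj; apply: convolutionZl; exact: steinbergP. Qed.

Lemma steinberg_scaleAr (k : R) f g :
  k *: steinberg_mul f g = steinberg_mul f (k *: g).
Proof. by apply: val_inj; apply: convolutionZr; exact: steinbergP. Qed.

HB.instance Definition _ := Lmodule_isAssocAlgebra.Build R steinberg
  steinberg_mulA steinberg_mulDl steinberg_mulDr
  steinberg_scaleAl steinberg_scaleAr.

Definition steinberg_char (K : set G) (oK : open K) (cK : compact K) : steinberg :=
  to_steinberg (is_steinberg_char R oK cK).

Definition steinberg_comp (Gam : groupType) (c : G -> Gam) (n : Gam)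
  : set steinberg := [set f | supp f `<=` c @^-1` [set n]].

Lemma steinberg_sumE (I : Type) (s : seq I) (F : I -> steinberg) a :
  (\sum_(i <- s) F i) a = \sum_(i <- s) F i a.
Proof.
have -> : (\sum_(i <- s) F i) a = (\sum_(i <- s) (F i : G -> R^o)) a.
  by congr (_ a); exact: (raddf_sum (val : steinberg -> (G -> R^o))).
by rewrite fct_sumE.
Qed.

Lemma steinberg_is_grading (Gam : groupType) (c : G -> Gam) :
  continuous_cocycle c -> is_grading (steinberg_comp c).
Proof.
move=> [cc cM].
have clo n : clopen (c @^-1` [set n]).
  apply: (@preimage_clopen _ (discrete_topology Gam)) cc.
  by split; [exact: discrete_open|exact: discrete_closed].
split.
- by move=> n a; rewrite /supp/= eqxx.
- move=> n f g fn gn a fga; have [fa|fa] := eqVneq (f a) 0; last exact: fn.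
  by apply: gn; apply: contraNN fga => /eqP ga; apply/eqP; rewrite /= !fctE fa ga addr0.
- move=> n k f fn a kfa; apply: fn; apply: contraNN kfa => /eqP fa.
  by apply/eqP; rewrite /= !fctE fa scaler0.
- move=> f.
  have /finite_seqP[s sE] : finite_set (c @` supp f).
    apply: (compact_ind (P := fun A => finite_set (c @` A))) (steinbergP f).2 _ _ _ _.
    + by rewrite image_set0.
    + by move=> A B AB; apply: sub_finite_set; exact: image_subset.
    + by move=> A B fA fB; rewrite image_setU finite_setU.
    + move=> a _; exists (c @^-1` [set c a]).
        by apply: open_nbhs_nbhs; split=> //; case: (clo (c a)).
      by apply: (@sub_finite_set _ _ [set c a]) => // _ [b /= -> <-].
  exists (undup s), (fun n => to_steinberg (is_steinberg_restr (clo n) (steinbergP f))).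
  split.
    move=> n a; rewrite /supp/= /restr.
    by case: ifPn => [/set_mem//|]; rewrite eqxx.
  apply: steinberg_eqP => a; rewrite steinberg_sumE /= /restr.
  have [sa|nsa] := boolP (c a \in undup s).
    rewrite (bigD1_seq (c a)) ?undup_uniq//= mem_set// big1 ?addr0// => n nca.
    by rewrite memNset//= => ca; rewrite ca eqxx in nca.
  have fa : f a = 0.
    apply/eqP/negPn/negP => fa; move/negP: nsa; apply; rewrite mem_undup.
    have : (c @` supp f) (c a) by exists a.
    by rewrite sE.
  by rewrite big1 ?fa// => n _; case: ifP.
- move=> s x_ us xn s0 n ns; apply: steinberg_eqP => a.
  have x0 m : c a <> m -> x_ m a = 0.
    by move=> cam; apply/eqP/negPn/negP => xa; apply: cam; exact: xn xa.
  have [can|/eqP can] := eqVneq (c a) n; last exact: x0.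
  have := congr1 (fun f : steinberg => f a) s0; rewrite /= steinberg_sumE.
  rewrite (bigD1_seq n)//= big1 ?addr0// => m nm.
  by apply: x0; rewrite can => mn; rewrite mn eqxx in nm.
- move=> m n f g fm gn a /convolution_supp[b [rb /fm/= fb /gn/= gb]].
  by rewrite -(gmulVKr rb)/= cM ?fb ?gb//; exact: gcompVM.
Qed.

End SteinbergAlgebra.

(* Main.v *)
(* Grading reduces a nonzero kernel element to a homogeneous one; left
   convolution with the characteristic function of a compact open bisection moves
   it to a kernel element g supported in G_e and nonzero at some unit u.
   Effectiveness of G_e yields a nonempty compact open set K of units near u,
   on which g is constant, such that no non-unit in the support of g has both its
   range and its source in K.  Hence 1_K * g * 1_K = g(u) 1_K. *)
Require Import Defs.
From HB Require Import structures.
From mathcomp Require Import all_boot all_algebra.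
From mathcomp Require Import all_classical topology.

Set Implicit Arguments.
Unset Strict Implicit.
Unset Printing Implicit Defensive.

Import GRing.Theory.

Local Open Scope classical_set_scope.
Local Open Scope ring_scope.

(** * Zero products and finite decompositions in a graded algebra *)

Lemma amulr0 (R : comPzRingType) (A : assocAlgType R) (x : A) : x ** 0 = 0.
Proof. by apply: (addrI (x ** 0)); rewrite -amulDr !addr0. Qed.

Lemma amul0r (R : comPzRingType) (A : assocAlgType R) (x : A) : 0 ** x = 0.
Proof. by apply: (addrI (0 ** x)); rewrite -amulDl !addr0. Qed.

(** [grading_sum] allows repeated indices, while [grading_direct] needs [uniq]. Merging repetitions
    multiplies each component by its multiplicity, which keeps it homogeneous. *)
Lemma grading_sum_uniq (R : comPzRingType) (Gam : groupType)
    (A : assocAlgType R) (A_ : Gam -> set A) (x : A) :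
  is_grading A_ -> exists (s : seq Gam) (x_ : Gam -> A),
    [/\ uniq s, forall n, A_ n (x_ n) & x = \sum_(n <- s) x_ n].
Proof.
move=> Agr; have [s [x_ [Ax ->]]] := grading_sum Agr x.
exists (undup s), (fun n => x_ n *+ count_mem n s); split.
- exact: undup_uniq.
- by move=> n; rewrite -scaler_nat; exact/(gradingZ Agr)/Ax.
- by rewrite -big_undup_iterop_count.
Qed.

(** * Units of a groupoid *)

Section Groupoid.
Variable G : groupoidType.
Implicit Types a b u : G.

Lemma gunits_gsrc a : gunits (gsrc a).
Proof. by rewrite -grngV; exact: gunits_grng. Qed.

Lemma grng_grng a : grng (grng a) = grng a.
Proof. by rewrite [X in grng X]/grng grngM//; exact: gcompVr. Qed.

Lemma gsrc_grng a : gsrc (grng a) = grng a.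
Proof. by rewrite [X in gsrc X]/grng gsrcM ?gsrcV//; exact: gcompVr. Qed.

Lemma grng_unit u : gunits u -> grng u = u.
Proof. by move=> [a _ <-]; exact: grng_grng. Qed.

Lemma gsrc_unit u : gunits u -> gsrc u = u.
Proof. by move=> [a _ <-]; exact: gsrc_grng. Qed.

Lemma gmul_gsrc a : gmul a (gsrc a) = a.
Proof.
have c1 : gcomp a (ginv a) := gcompVr a.
have c2 : gcomp (ginv a) a := gcompVl a.
by rewrite /gsrc -gmulA// -[in RHS](gmulVK c1) ginvK.
Qed.

(** The form matches the convolution term indexed by b = r(a). *)
Lemma gmulV_grng a : gmul (ginv (grng a)) a = a.
Proof.
have h : gcomp (grng a) a by rewrite /gcomp gsrc_grng.
have ga : gmul (grng a) a = a.
  by rewrite /grng gmulA ?gmul_gsrc//; [exact: gcompVr|exact: gcompVl].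
by rewrite -{2}ga gmulKV.
Qed.

Lemma gmulV_unit a b : grng a = grng b -> gunits (gmul (ginv a) b) -> a = b.
Proof.
move=> rab ub; have := gmulVKr rab.
by rewrite -(grng_unit ub) grngVM// gmul_gsrc.
Qed.

End Groupoid.

(** * Topology of the unit space and effectiveness *)

Lemma cocycle_fiber_open (G : topologicalGroupoidType) (Gam : groupType)
    (c : G -> Gam) (n : Gam) : continuous_cocycle c -> open (c @^-1` [set n]).
Proof.
move=> [cc _]; apply: (@open_comp _ (discrete_topology Gam)).
  by move=> a _; exact: cc.
exact: discrete_open.
Qed.

Section HausdorffAmple.
Variable G : hausdorffAmpleGroupoidType.
Implicit Types (a b u : G) (B K V D : set G).

(** A bisection around a unit contains, for b close to it, both b and r(b). These have the same
    range, so injectivity of r gives b = r(b). *)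
Lemma gunits_open : open (@gunits G).
Proof.
rewrite openE => u uu; rewrite /interior.
have [B [_ oB Bu _]] := ample_nbhs (@filterT _ (nbhs u) _).
have nB : nbhs u B by apply: open_nbhs_nbhs; split=> //; case: oB.
have nrB : nbhs u (@grng G @^-1` B).
  by apply: (@grng_continuous G u); rewrite grng_unit.
apply: filterS2 nB nrB => b Bb Brb.
by rewrite -(open_bisection_grng_inj oB Brb Bb (grng_grng b)); exact: gunits_grng.
Qed.

Lemma gunits_closed : closed (@gunits G).
Proof.
rewrite -[X in closed X]setCK; apply: open_closedC; rewrite openE => a nua.
have /eqP na : a <> grng a by move=> aE; apply: nua; rewrite aE; exact: gunits_grng.
have := @groupoid_hausdorff G; rewrite open_hausdorff => /(_ _ _ na).
move=> [[U V] /= [/set_mem Ua /set_mem Va] [oU oV /eqP UV]].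
have nU : nbhs a U by exact: open_nbhs_nbhs.
have nV : nbhs a (@grng G @^-1` V).
  by apply: grng_continuous; exact: open_nbhs_nbhs.
rewrite /interior; apply: filterS2 nU nV => b Ub /= + ub.
rewrite grng_unit// => Vb; by have : (U `&` V) b by []; rewrite UV.
Qed.

Lemma gsrc_image_open B : open_bisection B -> open (@gsrc G @` B).
Proof. by move=> [_ _ [_ _ [U oU ->]]]; apply: openI => //; exact: gunits_open. Qed.

(** Passes from the interior in the subspace [H] to open sets of [G]; units of [H] are units of
    [G]. *)
Lemma effective_open_iso (H V : set G) : effective H -> open V -> V `<=` H ->
  V `<=` ~` @gunits G -> (forall a, V a -> gsrc a = grng a) -> V = set0.
Proof.
move=> effH oV VH Vnu Viso; rewrite -subset0 => a Va.
rewrite -effH /interior.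
have nVa : nbhs a V by exact: open_nbhs_nbhs.
case: (@nbhs_subspaceP _ H a) => [_|]; last by move=> /(_ (VH _ Va)).
apply: filterS nVa => b Vb _; split; first by split; [exact: VH|exact: Viso].
by move=> [d _ rd]; apply: (Vnu _ Vb); rewrite -rd; exact: gunits_grng.
Qed.

(** Compactness reduces [D] to one small bisection, where either effectiveness applies or a
    non-isotropy element lets Hausdorffness separate source from range. *)
Lemma effective_avoid (H D V : set G) : effective H -> open H -> compact D ->
  D `<=` H `\` @gunits G -> open V -> V `<=` @gunits G -> V !=set0 ->
  exists W, [/\ open W, W `<=` V, W !=set0 &
    forall a, D a -> W (gsrc a) -> W (grng a) -> False].
Proof.
move=> effH oH cD DH; move: V.
(* Quantifying over all [V] lets a union be treated by shrinking twice in succession. *)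
pose P D := forall V, open V -> V `<=` @gunits G -> V !=set0 ->
  exists W, [/\ open W, W `<=` V, W !=set0 &
    forall a, D a -> W (gsrc a) -> W (grng a) -> False].
change (P D).
apply: (compact_ind cD).
- by move=> V oV _ V0; exists V; split=> // a [].
- move=> A B AB PB V oV Vu V0; have [W [oW WV W0 h]] := PB V oV Vu V0.
  by exists W; split=> // a /AB; exact: h.
- move=> A B PA PB V oV Vu V0; have [W [oW WV W0 hW]] := PA V oV Vu V0.
  have [W' [oW' WW' W'0 hW']] := PB W oW (subset_trans WV Vu) W0.
  exists W'; split=> //; first exact: subset_trans WV.
  by move=> a [Aa|Ba] Ws Wr; [apply: (hW a) => //; exact: WW'|exact: (hW' a)].
move=> x Dx.
have nx : nbhs x (H `&` ~` @gunits G).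
  apply: open_nbhs_nbhs; split; last exact: DH.
  by apply: openI => //; apply: closed_openC; exact: gunits_closed.
have [B [_ oB Bx BH]] := ample_nbhs nx.
have oB' : open B by case: oB.
exists B; first exact: open_nbhs_nbhs.
move=> V oV Vu V0.
(* If [O] consists of isotropy, effectiveness makes it empty and [V] itself avoids [B]. *)
pose O := B `&` (@gsrc G @^-1` V) `&` (@grng G @^-1` V).
have oO : open O.
  apply: openI; first apply: openI => //.
  - by apply: open_comp => // b _; exact: gsrc_continuous.
  - by apply: open_comp => // b _; exact: grng_continuous.
have [[a [[[Ba Vsa] Vra] /eqP nsr]]|iso] :=
    pselect (exists a, O a /\ gsrc a <> grng a); last first.
  have O0 : O = set0.
    apply: (effective_open_iso effH oO).
    - by move=> b [[/BH[]]].
    - by move=> b [[/BH[]]].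
    - by move=> b Ob; apply: contrapT => nb; apply: iso; exists b.
  exists V; split=> // b Bb Vs Vr.
  by have : O b by []; rewrite O0.
have := @groupoid_hausdorff G; rewrite open_hausdorff => /(_ _ _ nsr).
move=> [[W1 W2] /= [/set_mem W1a /set_mem W2a] [oW1 oW2 /eqP W12]].
have na : nbhs a (B `&` (@gsrc G @^-1` (V `&` W1)) `&` (@grng G @^-1` W2)).
  apply: open_nbhs_nbhs; split; last by [].
  apply: openI; first apply: openI => //.
  - by apply: open_comp; [move=> b _; exact: gsrc_continuous|exact: openI].
  - by apply: open_comp => // b _; exact: grng_continuous.
have [C [_ oC Ca CB]] := ample_nbhs na.
(* This set lies in [W1], while any element of [B] with source in it belongs to [C], by injectivity
   of s on [B], and so has range in [W2]. *)
exists (@gsrc G @` C); split.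
- exact: gsrc_image_open.
- by move=> _ [b /CB[[_ []]] + _ _ <-].
- by exists (gsrc a), a.
- move=> b Bb [d Cd dE] [d' Cd' d'E].
  have [[Bd _] W2d] := CB _ Cd; have [[_ [_ W1d']] _] := CB _ Cd'.
  have db := open_bisection_gsrc_inj oB Bd Bb dE.
  have : (W1 `&` W2) (grng b) by split; [rewrite -d'E|rewrite -db].
  by rewrite W12.
Qed.

End HausdorffAmple.

(** * Convolution with characteristic functions *)

Section Steinberg.
Variables (G : hausdorffAmpleGroupoidType) (R : comPzRingType).
Implicit Types (f g : steinberg G R) (K : set G).

Lemma steinberg_charMl K (oK : open K) (cK : compact K) f a :
  open_bisection K -> K `<=` @gunits G ->
  (steinberg_char R oK cK ** f) a = if grng a \in K then f a else 0.
Proof.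
move=> bK Ku; have sK : supp (steinberg_char R oK cK) `<=` K.
  move=> b; rewrite /supp/=.
  by have [/set_mem//|_] := boolP (b \in K); rewrite eqxx.
change (convolution (steinberg_char R oK cK) f a = if grng a \in K then f a else 0).
case: ifPn => [ra|nra].
  rewrite (@convolution_bisection _ _ _ _ _ _ (grng a) bK sK (set_mem ra)) ?grng_grng//.
  by rewrite /= ra mul1r gmulV_grng.
apply/eqP; apply: contraNT nra => /convolution_supp[b [rb /sK Kb _]].
by rewrite -rb grng_unit ?mem_set//; exact: Ku.
Qed.

(** A nonzero term at b needs the inverse of b times a to be a unit, which forces b = a. *)
Lemma steinberg_charMr K (oK : open K) (cK : compact K) f a :
  K `<=` @gunits G ->
  (f ** steinberg_char R oK cK) a = if gsrc a \in K then f a else 0.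
Proof.
move=> Ku.
change (convolution f (steinberg_char R oK cK) a = if gsrc a \in K then f a else 0).
rewrite /convolution (@fsum_widen _ _ _ [set a]).
- rewrite fsbig_set1 /= -/(gsrc a).
  by case: ifP; rewrite ?mulr1 ?mulr0.
- by move=> b ->.
- move=> b /= rb nba; case: (boolP (_ \in K)) => [/set_mem/Ku /(gmulV_unit rb)//|_].
  by rewrite mulr0.
Qed.

(** Take h = 1_B for a compact open bisection B around the inverse of a on which [c] is constant.
    The degrees cancel, and at s(a) only the inverse of a contributes. *)
Lemma homogeneous_shift (Gam : groupType) (c : G -> Gam) n f a :
  continuous_cocycle c -> steinberg_comp c n f -> f a != 0 ->
  exists h, supp (h ** f) `<=` c @^-1` [set 1%g] /\ (h ** f) (gsrc a) = f a.
Proof.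
move=> ccoc fn fa; have [_ cM] := ccoc.
have nia : nbhs (ginv a) (c @^-1` [set c (ginv a)]).
  by apply: open_nbhs_nbhs; split=> //; exact: cocycle_fiber_open.
have [B [cB bB Ba BU]] := ample_nbhs nia.
have oB : open B by case: bB.
have sB : supp (steinberg_char R oB cB) `<=` B.
  move=> b; rewrite /supp/=.
  by have [/set_mem//|_] := boolP (b \in B); rewrite eqxx.
exists (steinberg_char R oB cB); split.
  move=> x /convolution_supp[b [rb /sB/BU/= cb /fn/= cbx]].
  rewrite -(gmulVKr rb) cM; last exact: gcompVM.
  have ca : c a = n by exact: fn.
  rewrite cb cbx -ca -cM; last exact: gcompVl.
  (* The value of [c] at a unit is idempotent in a group, hence the identity. *)
  have : c (gsrc a) = (c (gsrc a) * c (gsrc a))%g.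
    have uu := gunits_gsrc a.
    have h : gcomp (gsrc a) (gsrc a) by rewrite /gcomp gsrc_unit ?grng_unit.
    by rewrite -cM// -[in X in gmul _ X](gsrc_unit uu) gmul_gsrc.
  by move=> /(congr1 (fun y => y * (c (gsrc a))^-1)%g); rewrite mulgK mulgV.
change (convolution (steinberg_char R oB cB) f (gsrc a) = f a).
rewrite (convolution_bisection _ bB sB Ba).
  by rewrite /= mem_set// mul1r ginvK gmul_gsrc.
by rewrite grngV grng_unit//; exact: gunits_gsrc.
Qed.

Lemma compress_to_units (H : set G) g u : effective H -> open H ->
  supp g `<=` H -> gunits u -> g u != 0 ->
  exists (K : set G) (oK : open K) (cK : compact K),
    [/\ K `<=` @gunits G, K !=set0 &
      steinberg_char R oK cK ** g ** steinberg_char R oK cK =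
        (g u : R) *: steinberg_char R oK cK].
Proof.
move=> effH oH gH uu gu; have [lg cg] := steinbergP g.
(* Shrinking inside [V] keeps [g] constant on [K], so the diagonal part of the product is a multiple
   of 1_K. *)
pose V := @gunits G `&` (g @^-1` [set g u]).
have oV : open V.
  by apply: openI; [exact: gunits_open|exact: locally_constant_open lg].
have cD : compact (supp g `&` ~` @gunits G).
  by apply: compact_closedI => //; apply: open_closedC; exact: gunits_open.
have DH : supp g `&` ~` @gunits G `<=` H `\` @gunits G by exact: setSI.
have [W [oW WV [w Ww] hW]] :=
  effective_avoid effH oH cD DH oV (@subIsetl _ _ _) (ex_intro _ u (conj uu erefl)).
have [K [cK bK Kw KW]] := ample_nbhs (open_nbhs_nbhs (conj oW Ww)).
have oK : open K by case: bK.
have KV := subset_trans KW WV.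
have Ku : K `<=` @gunits G by move=> b /KV[].
exists K, oK, cK; split=> //; first by exists w.
apply: steinberg_eqP => a; rewrite steinberg_charMr// steinberg_charMl//.
change ((if gsrc a \in K then if grng a \in K then g a else 0 else 0) = (g u : R) * (a \in K)%:R).
have [aK|naK] := boolP (a \in K).
  have [ua ga] := KV _ (set_mem aK).
  by rewrite gsrc_unit// grng_unit// aK mulr1.
rewrite [RHS](mulr0 (g u : R)); case: ifP => // sa; case: ifP => // ra.
have [//|ga] := eqVneq (g a) 0.
(* A unit equals its range, so it would lie in [K]; a non-unit in the support is excluded by the
   choice of [W]. *)
have [ua|nua] := pselect (gunits a).
  by move: naK; rewrite -(grng_unit ua) ra.
by case: (hW a) => //; exact/KW/set_mem.
Qed.

End Steinberg.

(** Requiring [K] nonempty excludes the trivial witness 1_K = 0. *)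
Theorem theorem3p4 (G : hausdorffAmpleGroupoidType) (R : comPzRingType)
    (Gam : groupType) (c : G -> Gam) (c_cocycle : continuous_cocycle c)
    (Ge_effective : effective (c @^-1` [set 1%g]))
    (A : assocAlgType R) (A_ : Gam -> set A) (A_grading : is_grading A_)
    (pi : {linear steinberg G R -> A}) (pi_mul : {morph pi : f g / f ** g})
    (pi_graded : forall n : Gam, pi @` steinberg_comp c n `<=` A_ n)
    (pi_ker : pi @^-1` [set 0] <> [set 0]) :
  exists (K : set G) (oK : open K) (cK : compact K) (r : R),
    [/\ K `<=` @gunits G, K !=set0, r != 0 &
        pi (r *: steinberg_char R oK cK) = 0].
Proof.
have [f [f0 pif]] : exists f, f != 0 /\ pi f = 0.
  apply: contrapT => nex; apply: pi_ker; apply/seteqP; split=> f /=.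
    move=> pif; apply: contrapT => /eqP f0; apply: nex; by exists f.
  by move=> ->; rewrite linear0.
have [s [f_ [us fn fE]]] := grading_sum_uniq f (steinberg_is_grading R c_cocycle).
(* The images of the components are homogeneous of distinct degrees and sum to [pi f] = 0, so
   directness in [A] kills each one. *)
have pifn n : n \in s -> pi (f_ n) = 0.
  apply: (grading_direct A_grading (x_ := pi \o f_) us) => [m|].
    by apply: pi_graded; exists (f_ m).
  by rewrite -linear_sum -fE.
have [n ns fn0] : exists2 n, n \in s & f_ n <> 0.
  apply: contrapT => nex; move/eqP: f0; apply; rewrite fE big_seq big1// => n ns.
  by apply: contrapT => fn0; apply: nex; exists n.
have [a fna] : exists a, f_ n a != 0.
  apply: contrapT => nex; apply: fn0; apply: steinberg_eqP => a.
  by apply/eqP; apply: contrapT => /negP fna; apply: nex; exists a.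
have [h [hH ha]] := homogeneous_shift c_cocycle (fn n) fna.
have oGe := cocycle_fiber_open 1%g c_cocycle.
rewrite -ha in fna.
have [K [oK [cK [Ku K0 KE]]]] :=
  compress_to_units Ge_effective oGe hH (gunits_gsrc a) fna.
(* The scalar multiple of 1_K is a product with the factor [f_ n], which [pi] kills. *)
exists K, oK, cK, ((h ** f_ n) (gsrc a)); split=> //.
by rewrite -KE !pi_mul pifn// !amulr0 amul0r.
Qed.
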